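(* Let $G=(V,E)$ be a connected Eulerian digraph and let $N$ be the maximum number of arcs of an acyclic arc set of $G$. Then for every vertex $s$ of $G$ there is an acyclic arc set of $G$ with $N$ arcs that contains no arc whose head is $s$.
   Context: Digraphs are finite and simple. A digraph is Eulerian if every vertex has in-degree equal to out-degree. For $A\subseteq E$, $G[A]$ denotes the digraph with vertex set $V$ and arc set $A$. An acyclic arc set of $G$ is a subset $A\subseteq E$ such that $G[A]$ has no directed cycle. *)

(* Defs.v *)
From mathcomp Require Import all_boot.

Set Implicit Arguments.
Unset Strict Implicit.
Unset Printing Implicit Defensive.

(* A digraph on the vertex type V is given by its arc set E : {set V * V};
   (u, v) \in E is an arc with tail u and head v. Multiple arcs are excluded
   by the representation; opposite arcs (u, v), (v, u) may coexist, and then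
   they form a directed cycle of length 2. *)

Section Digraph.
Variable V : finType.
Implicit Types E A : {set V * V}.

Definition simple_digraph E : Prop := forall v : V, (v, v) \notin E.

Definition arc E : rel V := [rel u v | (u, v) \in E].

Definition indegree E (v : V) : nat := #|[set a in E | a.2 == v]|.
Definition outdegree E (v : V) : nat := #|[set a in E | a.1 == v]|.

Definition eulerian E : Prop := forall v : V, indegree E v = outdegree E v.

(* Connectedness of the underlying undirected graph. *)
Definition connected_digraph E : Prop :=
  forall u v : V, connect [rel x y | arc E x y || arc E y x] u v.

(* [ucycle] accepts the empty sequence, which is not a cycle of the digraph. *)
Definition directed_cycle E (c : seq V) : Prop :=
  c <> [::] /\ ucycle (arc E) c.

Definition acyclic_arc_set E A : Prop :=
  A \subset E /\ ~ (exists c : seq V, directed_cycle A c).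

Definition max_acyclic_size E (N : nat) : Prop :=
  (exists A, acyclic_arc_set E A /\ #|A| = N) /\
  (forall A, acyclic_arc_set E A -> #|A| <= N).

End Digraph.

(* Main.v *)
Require Import Defs.
From mathcomp Require Import all_boot.

Set Implicit Arguments.
Unset Strict Implicit.
Unset Printing Implicit Defensive.

(** Let A be a maximum acyclic arc set and Y the set of vertices reachable from
    s in A, so that no arc of A leaves Y.  Replace the arcs of A entering Y by
    all the arcs of E leaving Y: since E is Eulerian, as many arcs of E enter Y
    as leave it, hence no arc is lost.  The new set is acyclic because a cycle
    can no longer enter Y, and no arc has head s, since such an arc would come
    from Y and close a cycle in A. *)

Section Digraph.
Variable V : finType.
Implicit Types (E A : {set V * V}) (X : {set V}).

Lemma sum_outdegree E X :
  \sum_(v in X) outdegree E v = #|[set a in E | a.1 \in X]|.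
Proof.
rewrite -sum1_card (partition_big (fun a : V * V => a.1) (mem X)) /=; last first.
  by move=> a; rewrite inE => /andP[].
apply: eq_bigr => v vX; rewrite sum1dep_card; apply: eq_card => a.
by rewrite !inE; case: eqP => [->|]; rewrite ?vX ?andbT ?andbF.
Qed.

Lemma sum_indegree E X :
  \sum_(v in X) indegree E v = #|[set a in E | a.2 \in X]|.
Proof.
rewrite -sum1_card (partition_big (fun a : V * V => a.2) (mem X)) /=; last first.
  by move=> a; rewrite inE => /andP[].
apply: eq_bigr => v vX; rewrite sum1dep_card; apply: eq_card => a.
by rewrite !inE; case: eqP => [->|]; rewrite ?vX ?andbT ?andbF.
Qed.

(** Summing the degrees over [X] counts the arcs with tail in [X] and those with head in [X]; the
    arcs inside [X] occur in both counts and cancel. *)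
Lemma eulerian_cut E X : eulerian E ->
  #|[set a in E | (a.1 \in X) && (a.2 \notin X)]| =
  #|[set a in E | (a.1 \notin X) && (a.2 \in X)]|.
Proof.
move=> eulE.
have : \sum_(v in X) outdegree E v = \sum_(v in X) indegree E v.
  by apply: eq_bigr => v _; rewrite eulE.
rewrite sum_outdegree sum_indegree.
rewrite -(cardsID [set a | a.2 \in X] [set a in E | a.1 \in X]).
rewrite -(cardsID [set a | a.1 \in X] [set a in E | a.2 \in X]).
have -> : [set a in E | a.1 \in X] :&: [set a | a.2 \in X] =
          [set a in E | a.2 \in X] :&: [set a | a.1 \in X].
  by apply/setP => a; rewrite !inE andbAC.
move/addnI; congr (_ = _); apply: eq_card => a; rewrite !inE.
  by rewrite andbC -andbA.
by rewrite andbCA.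
Qed.

Lemma connect_directed_cycle A u v :
  connect (Defs.arc A) v u -> (u, v) \in A -> exists c, directed_cycle A c.
Proof.
case/connectP => p /shortenP[q pathq uq _] -> Auv; exists (v :: q).
by split=> //; rewrite /ucycle uq /= rcons_path pathq /= /Defs.arc /= Auv.
Qed.

(** The first part also drops the arcs of [A] that leave [X]; when [A] is a subset of [E], the
    second part restores them. *)
Definition switch E A X : {set V * V} :=
  [set a in A | (a.1 \in X) == (a.2 \in X)]
  :|: [set a in E | (a.1 \in X) && (a.2 \notin X)].

Lemma switch_acyclic E A X :
  acyclic_arc_set E A -> acyclic_arc_set E (switch E A X).
Proof.
case=> /subsetP sAE acycA; split.
  by apply/subsetP => a; rewrite !inE => /orP[/andP[/sAE]|/andP[]].
case=> c [c0 /andP[cyc uc]]; apply: acycA; exists c; split=> //.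
(* No arc of the switched set enters [X], so a walk that is outside [X] stays outside. *)
have outX u v : connect (Defs.arc (switch E A X)) u v -> u \notin X -> v \notin X.
  case/connectP => p + ->; elim: p u => //= w p IH u /andP[uw pw] uX.
  apply: IH pw _; move: uw.
  by rewrite /Defs.arc /= !inE /= (negbTE uX) andbF orbF => /andP[_ /eqP <-].
rewrite /ucycle uc andbT; apply: (sub_in_cycle _ (allss c)) (cyc) => u v uc' vc.
rewrite /Defs.arc /= !inE /= => /orP[/andP[]//|/and3P[_ uX vX]].
(* If an arc of the cycle left [X], the rest of the cycle would lead from [v] back to [u] in [X]. *)
by have /outX/(_ vX) := connect_cycle cyc vc uc'; rewrite uX.
Qed.

(** The arcs of [A] lost are those crossing the cut. By closedness they all enter [X], so the arcs
    of [E] entering [X], as numerous as those leaving it, bound their number. *)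
Lemma leq_card_switch E A X : eulerian E -> A \subset E ->
  (forall u v, (u, v) \in A -> u \in X -> v \in X) -> #|A| <= #|switch E A X|.
Proof.
move=> eulE /subsetP sAE closedX.
rewrite cardsU disjoint_setI0 ?cards0 ?subn0; last first.
  rewrite disjoint_subset; apply/subsetP => a; rewrite !inE => /andP[_ /eqP->].
  by rewrite andbN andbF.
rewrite eulerian_cut // -(cardsID [set a | (a.1 \in X) == (a.2 \in X)] A).
rewrite leq_add //; apply: subset_leq_card; apply/subsetP => -[u v].
  by rewrite !inE.
rewrite !inE /= => /andP[+ Auv]; rewrite (sAE _ Auv).
by have := closedX _ _ Auv; case: (u \in X); case: (v \in X) => // /(_ isT).
Qed.

End Digraph.

Theorem theorem1 (V : finType) (E : {set V * V}) (N : nat)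
    (hsimple : simple_digraph E) (hconn : connected_digraph E)
    (heul : eulerian E) (hN : max_acyclic_size E N) :
  forall s : V, exists A : {set V * V},
    acyclic_arc_set E A /\ #|A| = N /\ (forall u : V, (u, s) \notin A).
Proof.
move=> s; case: hN => -[A [acycA cardA]] maxN.
pose Y := [set v | connect (Defs.arc A) s v].
have acycS := switch_acyclic Y acycA.
exists (switch E A Y); split=> //; split.
  apply/eqP; rewrite eqn_leq maxN //= -cardA leq_card_switch //; first by case: acycA.
  by move=> u v Auv; rewrite !inE => su; apply: connect_trans su (connect1 _).
(* As [s] lies in [Y], an arc into [s] cannot leave [Y]; it is thus an arc of [A] with its tail [u]
   in [Y]. *)
move=> u; rewrite !inE /= connect0 !andbF orbF eqb_id.
apply/negP => /andP[Aus su]; case: acycA => _; apply.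
exact: connect_directed_cycle su Aus.
Qed.
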